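(* There is a constant $\gamma$ such that the following holds for all sufficiently large $n$, every real $C\ge 4$ and every integer $d\ge 2\log n$. Suppose that $G$ is an $n$-vertex graph with $d(G)\ge\gamma d\log n$. Then there is a subgraph $H\subseteq G$ which is a $(\frac18,c,s)$-expander satisfying $\Delta(H)\le d$, $d(H)\ge d(1-\mu)$ and $\delta(H)\ge d(H)/2$, where $c:=\frac{C(C-1)}{C-2}$, $s:=\frac{d}{4(\log|V(H)|)^c}$ and $\mu:=(\log|V(H)|)^{-(C-2)}$.
   Context: All graphs are finite and simple, and logarithms are base $2$. For a graph $G$, $d(G)$, $\delta(G)$, $\Delta(G)$ denote its average, minimum and maximum degree. For $X\subseteq V(G)$, $N_G(X)$ is the set of vertices outside $X$ adjacent to at least one vertex of $X$. For $F\subseteq E(H)$, $H-F$ is $H$ with the edges of $F$ deleted. A graph $H$ is an $(\varepsilon,c,s)$-expander if for every $U\subseteq V(H)$ and $F\subseteq E(H)$ with $1\le|U|\le\frac23|V(H)|$ and $|F|\le s|U|$ we have $|N_{H-F}(U)|\ge\frac{\varepsilon}{(\log|V(H)|)^c}\cdot|U|$. *)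

(* Defs.v *)
From HB Require Import structures.
From mathcomp Require Import all_boot all_order all_algebra.
From mathcomp Require Import reals exp.

Set Implicit Arguments.
Unset Strict Implicit.
Unset Printing Implicit Defensive.

Import Order.TTheory GRing.Theory Num.Theory.

Local Open Scope ring_scope.

(* A finite simple graph whose vertices are some of the elements of T;
   edges are two-element sets of vertices. *)
Record graph (T : finType) := Graph {
  vset : {set T};
  eset : {set {set T}};
  eset_wf : [forall e in eset, (e \subset vset) && (#|e| == 2)]
}.

Section Graphs.
Variable T : finType.
Implicit Types (G H : graph T) (U X : {set T}) (F : {set {set T}}).

Definition adj G (x y : T) : bool := [set x; y] \in eset G.

Definition deg G (x : T) : nat := #|[set y in vset G | adj G x y]|.

Definition max_deg G : nat := (\max_(x in vset G) deg G x)%N.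

(* The default value of the minimum is max_deg G, which never lies below a
   vertex degree; so this is the true minimum as soon as vset G is nonempty. *)
Definition min_deg G : nat := \big[minn/max_deg G]_(x in vset G) deg G x.

Definition avg_deg (R : realType) G : R :=
  (\sum_(x in vset G) deg G x)%N%:R / #|vset G|%:R.

Definition subgraph H G : bool :=
  (vset H \subset vset G) && (eset H \subset eset G).

Definition nbhd G X : {set T} :=
  [set y in vset G :\: X | [exists x in X, adj G x y]].

Lemma del_edges_wf H F :
  [forall e in eset H :\: F, (e \subset vset H) && (#|e| == 2)].
Proof.
apply/forall_inP => e /setDP[eH _].
exact: (forall_inP (eset_wf H)).
Qed.

Definition del_edges H F : graph T := Graph (del_edges_wf H F).

End Graphs.

Definition log2 (R : realType) (x : R) : R := ln x / ln 2.

(* When H has a single vertex, log2 vanishes, but the condition on U is then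
   void; so no junk value of the quotient is ever used. *)
Definition expander (R : realType) (T : finType) (eps c s : R) (H : graph T)
    : Prop :=
  forall (U : {set T}) (F : {set {set T}}),
    U \subset vset H -> F \subset eset H ->
    (1 <= #|U|)%N -> #|U|%:R <= 2 / 3 * #|vset H|%:R :> R ->
    #|F|%:R <= s * #|U|%:R ->
    eps / (log2 #|vset H|%:R `^ c) * #|U|%:R
      <= #|nbhd (del_edges H F) U|%:R.

(* Main.v *)
Require Import Defs.
From HB Require Import structures.
From mathcomp Require Import all_boot all_order all_algebra.
From mathcomp Require Import reals exp.
From mathcomp Require Import zify ring lra.

Set Implicit Arguments.
Unset Strict Implicit.
Unset Printing Implicit Defensive.

Import Order.TTheory GRing.Theory Num.Theory.

Local Open Scope ring_scope.

(* G contains a bipartite graph, with parts A and B, |A| >= |B|, in which every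
   vertex of A has degree at least t = d(G)/4. Among the pairs S of A, T of B
   with |S| = |T| > 0, take one minimising the sum over a in S of
   g^(-deg_T(a)), where g = 1 + 1/(2d). It spans a d-regular subgraph:
   otherwise, by Hall's condition, the vertices of some R in T receive too few
   edges; let Z be the vertices of S with at least d neighbours in R, and
   m = |R| - |Z| > 0. The vertices of S - Z send fewer than d m edges to R, so
   deleting R, Z and the m vertices of S - Z with the largest weights decreases
   the sum. (R = T is impossible, since then some weight is at least 1/2, while
   the initial sum is at most |B| g^(-t) < 1/2.)

   In the d-regular graph let X be a smallest vertex set, |X| >= 3, whose induced
   average degree is at least d (1 - mu(|X|)), where mu decreases in |X|. A vertex
   of small degree, or a set U violating the expansion, splits off a smaller set
   which is still dense enough. *)

(** * Factors of bipartite graphs *)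

Section BipartiteFactor.
Variables I J : finType.
Implicit Types (E : {set I * J}) (S : {set I}) (R T : {set J}).

Definition edges_into E (i : I) R : nat := (\sum_(j in R) ((i, j) \in E))%N.

(** The min-cut condition for a subgraph of [E] with degree [r] at every vertex of [T] and at most
    [r] at every vertex of [S]. *)
Definition hall_condition (r : nat) S T E : bool :=
  [forall (R : {set J} | R \subset T),
    r * #|R| <= \sum_(i in S) minn r (edges_into E i R)]%N.

Lemma edges_intoS E i R1 R2 :
  R1 \subset R2 -> (edges_into E i R1 <= edges_into E i R2)%N.
Proof.
move=> sR; rewrite /edges_into [leqRHS](big_setID R1) /=.
by rewrite (setIidPr sR) leq_addr.
Qed.

Lemma edges_into_setID E i R T : R \subset T ->
  edges_into E i T = (edges_into E i R + edges_into E i (T :\: R))%N.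
Proof.
by move=> sRT; rewrite /edges_into (big_setID R) /= (setIidPr sRT).
Qed.

Lemma edges_intoUI E i R1 R2 :
  (edges_into E i (R1 :|: R2) + edges_into E i (R1 :&: R2)
    = edges_into E i R1 + edges_into E i R2)%N.
Proof.
rewrite (edges_into_setID E i (subsetUl R1 R2)).
rewrite (edges_into_setID E i (subsetIr R1 R2)) setDUl setDv set0U.
by rewrite -addnA; congr addn; rewrite addnC setDIr setDv setU0.
Qed.

(** Submodularity: [edges_into] is modular and monotone in the set, and truncating at [r] preserves
    the inequality. It makes tight sets closed under intersection. *)
Lemma edges_into_minU E i r R1 R2 :
  (minn r (edges_into E i (R1 :|: R2)) + minn r (edges_into E i (R1 :&: R2))
    <= minn r (edges_into E i R1) + minn r (edges_into E i R2))%N.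
Proof.
have := edges_intoUI E i R1 R2.
have := edges_intoS E i (subsetIl R1 R2).
have := edges_intoS E i (subsetIr R1 R2).
have := edges_intoS E i (subsetUl R1 R2).
have := edges_intoS E i (subsetUr R1 R2).
by lia.
Qed.

Lemma edges_into1D E i0 j0 i R :
  (edges_into E i R
     <= edges_into (E :\ (i0, j0)) i R + ((i == i0) && (j0 \in R)))%N.
Proof.
rewrite /edges_into.
have [jR|jR] := boolP (j0 \in R); last first.
  rewrite andbF addn0; apply: leq_sum => j jR'.
  rewrite !inE xpair_eqE; case: (j =P j0) => [jj0|_]; last by rewrite andbF.
  by rewrite -jj0 jR' in jR.
rewrite (bigD1 j0) //= [in leqRHS](bigD1 j0) //= andbT.
have <- : (\sum_(j in R | j != j0) ((i, j) \in E) =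
   \sum_(j in R | j != j0) ((i, j) \in E :\ (i0, j0)))%N.
  apply: eq_bigr => j /andP[_ /negbTE jj0].
  by rewrite !inE xpair_eqE jj0 andbF.
rewrite !inE xpair_eqE eqxx andbT.
by case: (i == i0); case: (_ \in E) => //=; lia.
Qed.

(* Delete edges as long as the condition survives. At the end every edge lies
   on a tight set; tight sets are closed under intersection, so all edges at a
   given [j] share one, which forces the degree of [j] down to [r]. *)
Lemma hall_minimal r S T E : hall_condition r S T E ->
  exists2 E' : {set I * J}, E' \subset E & hall_condition r S T E' /\
    forall j, j \in T -> (\sum_(i in S) ((i, j) \in E') = r)%N.
Proof.
have [n] := ubnP #|E|; elim: n E => // n IHn E ltEn hallE.
have [/existsP[e /andP[eE hallEe]]|] :=
  boolP [exists e, (e \in E) && hall_condition r S T (E :\ e)].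
  have [|E' sE' hE'] := IHn (E :\ e) _ hallEe.
    by rewrite (cardsD1 e E) eE in ltEn; lia.
  by exists E' => //; apply: subset_trans sE' (subsetDl _ _).
move=> /existsPn crit; exists E => //; split=> // j jT.
have hallP R : R \subset T ->
    (r * #|R| <= \sum_(i in S) minn r (edges_into E i R))%N.
  by move=> sRT; move/forall_inP: hallE; apply.
have ge_r : (r <= \sum_(i in S) ((i, j) \in E))%N.
  have /hallP : [set j] \subset T by rewrite sub1set.
  rewrite cards1 muln1 => /leq_trans; apply; apply: leq_sum => i _.
  by rewrite /edges_into big_set1 geq_minr.
apply/eqP; rewrite eqn_leq ge_r andbT leqNgt; apply/negP => gt_r.
pose tight R := [&& j \in R, R \subset T
  & (\sum_(i in S) minn r (edges_into E i R) <= r * #|R|)%N].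
have tightE i : i \in S -> (i, j) \in E ->
    exists2 R, tight R & (edges_into E i R <= r)%N.
  (* Deleting [(i, j)] breaks the condition at some [R]. The sum drops by at most one unit, and only
     if [j] is in [R]; so [j] is in [R] and [R] was tight. *)
  move=> iS ijE; have := crit (i, j); rewrite ijE /=.
  move=> /forall_inPn[R]; rewrite unfold_in -ltnNge => sRT ltR.
  have le1 k : (minn r (edges_into E k R) <=
      minn r (edges_into (E :\ (i, j)) k R) + ((k == i) && (j \in R)))%N.
    by have := edges_into1D E i j k R; lia.
  have sum1 : (\sum_(k in S) ((k == i) && (j \in R)) = (j \in R))%N.
    rewrite (bigD1 i) //= eqxx big1 ?addn0 // => k /andP[_ /negbTE ->] //.
  have := hallP R sRT.
  have leS : (\sum_(k in S) minn r (edges_into E k R) <=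
     \sum_(k in S) minn r (edges_into (E :\ (i, j)) k R) + (j \in R))%N.
    by rewrite -sum1 -big_split; apply: leq_sum => k _; apply: le1.
  move=> hR; have jR : j \in R.
    apply: contraLR (leq_trans hR leS) => /negbTE ->.
    by rewrite addn0 -ltnNge.
  exists R.
    by rewrite /tight jR sRT /= (leq_trans leS) // jR addn1.
  (* With more than [r] edges from [i] into [R], the truncation would hide the deletion. *)
  rewrite leqNgt; apply/negP => gtr.
  suff : (\sum_(k in S) minn r (edges_into E k R) <=
     \sum_(k in S) minn r (edges_into (E :\ (i, j)) k R))%N.
    by move=> /leq_ltn_trans/(_ ltR); rewrite ltnNge hR.
  apply: leq_sum => k _; have := edges_into1D E i j k R.
  by have [->|] := eqVneq k i; rewrite /= ?jR; lia.
have [i0 i0S i0E] : exists2 i, i \in S & (i, j) \in E.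
  apply/exists_inP/contraT => /exists_inPn noE.
  by move: gt_r; rewrite big1 // => i /noE/negbTE ->.
have [R0 tR0 _] := tightE i0 i0S i0E.
case: (arg_minnP (fun R : {set J} => #|R|) tR0) => R tR Rmin.
have [jR sRT tightR] := and3P tR.
have Rle i : i \in S -> (i, j) \in E -> (edges_into E i R <= r)%N.
  move=> iS ijE; have [Ri tRi leRi] := tightE i iS ijE.
  have [jRi sRiT tightRi] := and3P tRi.
  have tI : tight (R :&: Ri).
    rewrite /tight inE jR jRi (subset_trans (subsetIl _ _) sRT) /=.
    have sU : R :|: Ri \subset T by rewrite subUset sRT.
    rewrite -(leq_add2l (r * #|R :|: Ri|)) -mulnDr cardsUI mulnDr.
    apply: leq_trans (leq_add tightR tightRi).
    apply: leq_trans (leq_add (hallP _ sU) (leqnn _)) _.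
    by rewrite -!big_split; apply: leq_sum => k _; apply: edges_into_minU.
  apply: leq_trans leRi; apply: edges_intoS.
  have /eqP <- : R :&: Ri == R by rewrite eqEcard subsetIl Rmin.
  exact: subsetIr.
(* No neighbour of [j] is truncated on [R], so removing [j] costs the full degree of [j]. Tightness
   of [R] and the condition at [R :\ j] leave room for at most [r]. *)
have : (\sum_(i in S) minn r (edges_into E i (R :\ j)) +
        \sum_(i in S) ((i, j) \in E) <=
        \sum_(i in S) minn r (edges_into E i R))%N.
  rewrite -big_split; apply: leq_sum => i iS /=.
  have -> : edges_into E i R = (edges_into E i (R :\ j) + ((i, j) \in E))%N.
    by rewrite {1}/edges_into (big_setD1 j) //= addnC.
  have := Rle i iS; rewrite {1}/edges_into (big_setD1 j) //= -/(edges_into _ _ _).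
  move: (edges_into E i (R :\ j)) => m.
  by case: (_ \in E) => [/(_ isT)|_] /=; rewrite ?addn0 //; lia.
apply/negP; rewrite -ltnNge (leq_ltn_trans tightR) // (cardsD1 j R) jR.
rewrite mulnDr muln1 addnC.
apply: leq_ltn_trans (leq_add (hallP _ _) (leqnn r)) _.
  exact: subset_trans (subsetDl _ _) sRT.
by rewrite ltn_add2l.
Qed.

Lemma edges_into_exchange S T E :
  (\sum_(i in S) edges_into E i T
     = \sum_(j in T) \sum_(i in S) ((i, j) \in E))%N.
Proof. by rewrite exchange_big. Qed.

(** Double counting: by the condition at [T], the truncated degrees over [S] sum to at least
    [r * #|T|], which is both the number of edges and [r * #|S|]. So they agree with the degrees and
    with [r]. *)
Lemma hall_factor r S T E : #|S| = #|T| -> hall_condition r S T E ->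
  exists E' : {set I * J}, [/\ E' \subset E,
    forall j, j \in T -> (\sum_(i in S) ((i, j) \in E') = r)%N &
    forall i, i \in S -> edges_into E' i T = r].
Proof.
move=> cST /hall_minimal[E' sE' [hall' degT]]; exists E'; split=> //.
have tot : (\sum_(i in S) edges_into E' i T = r * #|T|)%N.
  rewrite edges_into_exchange (eq_bigr (fun=> r)) //.
  by rewrite sum_nat_const mulnC.
have /forall_inP/(_ T (subxx T)) geT := hall'.
have totr : (\sum_(i in S) r = r * #|T|)%N by rewrite sum_nat_const mulnC cST.
have eq_minn (F : I -> nat) :
    (forall k, minn r (edges_into E' k T) <= F k)%N ->
    (\sum_(k in S) F k = r * #|T|)%N ->
    forall i, i \in S -> minn r (edges_into E' i T) = F i.
  move=> leF sumF i iS.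
  have leS : (\sum_(k in S) minn r (edges_into E' k T) <= \sum_(k in S) F k)%N.
    by apply: leq_sum => k _; apply: leF.
  have [_] := leqif_sum (fun k (_ : k \in S) => leqif_eq (leF k)).
  have -> : (\sum_(k in S) minn r (edges_into E' k T) == \sum_(k in S) F k)%N.
    by lia.
  by move=> /esym/forall_inP/(_ i iS)/eqP.
move=> i iS; rewrite -(eq_minn (edges_into E' ^~ T)) // => [|k].
  by rewrite (eq_minn (fun=> r)) // => k; apply: geq_minl.
exact: geq_minr.
Qed.
End BipartiteFactor.

(** * Regular pairs *)

(** Greedy: the threshold [x] joins [Y], and a minimiser of [f] on the remainder becomes the new
    threshold. *)
Lemma split_by_value (K : realDomainType) (I : finType) (f : I -> K)
    (X : {set I}) (k : nat) : (k < #|X|)%N ->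
  exists (Y : {set I}) (x : I), [/\ Y \subset X, #|Y| = k, x \in X :\: Y,
    forall y, y \in Y -> f y <= f x & forall z, z \in X :\: Y -> f x <= f z].
Proof.
elim: k => [|k IHk] ltkX.
  have [x0 x0X] : exists x, x \in X by apply/set0Pn; rewrite -card_gt0.
  case: (arg_minP f x0X) => x xX xmin; exists set0, x.
  by rewrite sub0set cards0 setD0; split=> // y; rewrite inE.
have [Y [x [sYX cY xXY leY geX]]] := IHk (ltnW ltkX).
have [xY xX] := setDP xXY; move: xY xX => xX xY.
have sxYX : x |: Y \subset X by rewrite subUset sub1set xX.
have cxY : #|x |: Y| = k.+1 by rewrite cardsU1 xY cY.
have [x0 x0X] : exists x', x' \in X :\: (x |: Y).
  by apply/set0Pn; rewrite -card_gt0 cardsDS // cxY subn_gt0.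
case: (arg_minP f x0X) => x' x'X x'min.
have x'XY : x' \in X :\: Y by move: x'X; apply/subsetP/setDS/subsetUr.
exists (x |: Y), x'; split=> // y; rewrite !inE => /orP[/eqP ->|/leY le_yx].
  exact: geX.
exact: le_trans le_yx (geX _ x'XY).
Qed.

Lemma bernoulli_le (K : realDomainType) (x : K) (n : nat) :
  0 <= x -> 1 + x *+ n <= (1 + x) ^+ n.
Proof.
move=> x0; elim: n => [|n IHn]; first by rewrite mulr0n addr0 expr0.
rewrite exprS; apply: le_trans (ler_wpM2l _ IHn); last by rewrite addr_ge0.
have := mulrn_wge0 n x0; rewrite mulrS; nra.
Qed.

(** One more factor adds [(1 + e / r) / (2 * r)], at most [1 / r] because [e <= r]. This controls
    the growth of a weight whose vertex loses [e] edges. *)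
Lemma exp_le_linear (K : realFieldType) (r e : nat) : (0 < r)%N -> (e <= r)%N ->
  (1 + (2 * r)%:R^-1) ^+ e <= 1 + e%:R / r%:R :> K.
Proof.
move=> r0; have r0' : 0 < r%:R :> K by rewrite ltr0n.
elim: e => [|e IHe] ler; first by rewrite mul0r addr0 expr0.
rewrite exprSr; apply: le_trans (ler_wpM2r _ (IHe (ltnW ler))) _.
  by rewrite addr_ge0 // invr_ge0 ler0n.
have -> : (2 * r)%:R^-1 = r%:R^-1 / 2%:R :> K.
  by rewrite natrM invfM mulrC.
have le1 : e%:R / r%:R <= 1 :> K by rewrite ler_pdivrMr // mul1r ler_nat ltnW.
have : 0 < r%:R^-1 :> K by rewrite invr_gt0.
rewrite -[e.+1]addn1 natrD mulrDl mul1r; nra.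
Qed.

Section RegularPair.
Variables I J : finType.
Implicit Types (E : {set I * J}) (S : {set I}) (R T : {set J}).

Lemma regular_pair E S0 T0 (r k : nat) : (0 < r)%N -> (0 < #|T0|)%N ->
  #|S0| = #|T0| -> (2 * #|T0| < 2 ^ k)%N ->
  (forall i, i \in S0 -> 2 * r * k <= edges_into E i T0)%N ->
  exists S T E', [/\ S \subset S0, T \subset T0, (0 < #|T|)%N & E' \subset E] /\
    (forall j, j \in T -> (\sum_(i in S) ((i, j) \in E') = r)%N) /\
    (forall i, i \in S -> edges_into E' i T = r).
Proof.
move=> r0 T0_gt0 cST0 T0k degE.
pose g : rat := 1 + (2 * r)%:R^-1.
have g1 : 1 < g by rewrite ltrDl invr_gt0 ltr0n muln_gt0.
have g0 : 0 < g by apply: lt_trans g1.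
pose psi T i : rat := g ^- edges_into E i T.
have psi0 T i : 0 < psi T i by rewrite invr_gt0 exprn_gt0.
pose P (p : {set I} * {set J}) :=
  [&& p.1 \subset S0, p.2 \subset T0, 0 < #|p.2| & #|p.1| == #|p.2|]%N.
have P0 : P (S0, T0) by rewrite /P !subxx T0_gt0 cST0 eqxx.
pose Psi (p : {set I} * {set J}) := \sum_(i in p.1) psi p.2 i.
case: (arg_minP Psi P0) => -[S T] /and4P /= [sS0 sT0 T_gt0 /eqP cST] psi_min.
(* Bernoulli gives [g ^+ (2 * r) >= 2], so each of the [#|T0|] initial weights is at most
   [2 ^- k]. *)
have lt_half : \sum_(i in S) psi T i < 2^-1.
  apply: le_lt_trans (psi_min _ P0) _ => /=.
  apply: (@le_lt_trans _ _ (\sum_(i in S0) (2 ^+ k)^-1)).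
    apply: ler_sum => i iS0; rewrite lef_pV2 ?posrE ?exprn_gt0 //.
    apply: le_trans (ler_weXn2l (ltW g1) (degE i iS0)).
    rewrite exprM lerXn2r ?nnegrE ?exprn_ge0 ?(ltW g0) //.
    have /(bernoulli_le (2 * r)) : 0 <= (2 * r)%:R^-1 :> rat.
      by rewrite invr_ge0.
    by rewrite -(mulr_natr _^-1) mulVf // pnatr_eq0 -lt0n muln_gt0.
  rewrite sumr_const cST0 -(mulr_natl _ #|T0|) ltr_pdivrMr ?exprn_gt0 //.
  rewrite mulrC ltr_pdivlMr // -natrM -natrX ltr_nat mulnC //.
suff hallE : hall_condition r S T E.
  have [E' [sE' degT degS]] := hall_factor cST hallE.
  by exists S, T, E'.
apply/forall_inP => R sRT; rewrite leqNgt; apply/negP => ltR.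
pose Z := [set i in S | r <= edges_into E i R]%N.
have sZS : Z \subset S by apply/subsetP => i; rewrite inE => /andP[].
have ltrSZ i : i \in S :\: Z -> (edges_into E i R < r)%N.
  by case/setDP=> iS; rewrite inE iS -ltnNge.
have ltZR : (r * #|Z| + \sum_(i in S :\: Z) edges_into E i R < r * #|R|)%N.
  move: ltR; rewrite (big_setID Z) /= (setIidPr sZS).
  rewrite (eq_bigr (fun=> r)) => [|i]; last first.
    by rewrite inE => /andP[_ /minn_idPl].
  rewrite sum_nat_const [(#|Z| * r)%N]mulnC.
  rewrite (eq_bigr (fun i => edges_into E i R)) // => i /ltrSZ/ltnW.
  by move/minn_idPr.
have ltZ : (#|Z| < #|R|)%N.
  by rewrite -(ltn_pmul2l r0); apply: leq_ltn_trans (leq_addr _ _) ltZR.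
have cSZ : #|S :\: Z| = (#|T :\: R| + (#|R| - #|Z|))%N.
  rewrite !cardsDS // cST.
  by have := subset_leq_card sRT; have := subset_leq_card sZS; lia.
(* [Y] holds the lightest vertices of [S :\: Z]; [x] is the lightest of the [#|R| - #|Z|] discarded
   ones. *)
have [Y [x [sY cY xY leY geY]]] : exists (Y : {set I}) (x : I),
    [/\ Y \subset S :\: Z, #|Y| = #|T :\: R|, x \in (S :\: Z) :\: Y,
    forall y, y \in Y -> psi T y <= psi T x &
    forall z, z \in (S :\: Z) :\: Y -> psi T x <= psi T z].
  by apply: split_by_value; rewrite cSZ; lia.
have sYS : Y \subset S := subset_trans sY (subsetDl _ _).
(* If [R = T], the new pair would be empty; but then [x] has fewer than [r] neighbours in [T], so
   its weight alone is at least [1 / 2]. *)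
have [TR0|TR_gt0] := posnP #|T :\: R|.
  have RT : R = T.
    by apply/eqP; rewrite eqEsubset sRT -setD_eq0 -cards_eq0 TR0.
  have [xSZ _] := setDP xY; have [xS _] := setDP xSZ.
  have := lt_half; rewrite ltNge => /negP[].
  rewrite (bigD1 x) //= ler_wpDr ?sumr_ge0 // => [i _|]; first exact: ltW.
  rewrite lef_pV2 ?posrE ?exprn_gt0 //.
  have lt_xr := ltrSZ x xSZ; rewrite -RT.
  apply: le_trans (exp_le_linear rat r0 (ltnW lt_xr)) _.
  rewrite -[2]/(1 + 1) lerD2l ler_pdivrMr ?ltr0n // mul1r ler_nat.
  exact: ltnW.
have PY : P (Y, T :\: R).
  rewrite /P /= cY eqxx TR_gt0 (subset_trans sYS sS0).
  by rewrite (subset_trans (subsetDl _ _) sT0).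
have := psi_min _ PY; rewrite leNgt => /negP[] /=.
have r0' : 0 < r%:R :> rat by rewrite ltr0n.
(* Removing [R] multiplies the weight of [i] by a power of [g]; the increase is charged to [x],
   which weighs at least as much as [i]. *)
have psiY i : i \in Y -> psi (T :\: R) i <=
    psi T i + psi T x * ((edges_into E i R)%:R / r%:R).
  move=> iY; have le_r := ltnW (ltrSZ i (subsetP sY _ iY)).
  have -> : psi (T :\: R) i = psi T i * g ^+ edges_into E i R.
    rewrite /psi (edges_into_setID E i sRT) exprD invfM mulrAC mulVf ?mul1r //.
    by rewrite expf_neq0 // gt_eqF.
  apply: le_trans (ler_wpM2l (ltW (psi0 _ _)) (exp_le_linear rat r0 le_r)) _.
  rewrite mulrDr mulr1 lerD2l ler_wpM2r ?leY //.
  by rewrite divr_ge0.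
apply: le_lt_trans (ler_sum _ psiY) _; rewrite big_split /= -mulr_sumr.
rewrite -mulr_suml -natr_sum [ltRHS](big_setID Z) /= (setIidPr sZS).
rewrite [X in _ < _ + X](big_setID Y) /= (setIidPr sY).
(* The discarded vertices of [S :\: Z] save at least [psi T x] each. The increases on [Y] total
   less, as fewer than [r * (#|R| - #|Z|)] edges join [Y] to [R]. *)
apply: lt_le_trans (_ : \sum_(i in Y) psi T i
   + psi T x *+ (#|R| - #|Z|) <= _); last first.
  rewrite addrCA lerD2l -[leLHS]add0r lerD //.
    by apply: sumr_ge0 => i _; apply: ltW.
  have <- : #|(S :\: Z) :\: Y| = (#|R| - #|Z|)%N.
    by rewrite cardsDS // cY cSZ addKn.
  by rewrite -sumr_const; apply: ler_sum.
rewrite ltrD2l -(mulr_natr (psi T x)) ltr_pM2l // ltr_pdivrMr // -natrM ltr_nat.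
rewrite mulnBl 2![(_ * r)%N]mulnC ltn_subRL.
apply: leq_ltn_trans ltZR; rewrite leq_add2l.
by rewrite [leqRHS](big_setID Y) /= (setIidPr sY) leq_addr.
Qed.
End RegularPair.

(** * Dense, bipartite and regular subgraphs *)

Section InducedDegrees.
Local Open Scope nat_scope.
Variables (V : finType) (e : rel V).
Hypotheses (e_sym : symmetric e) (e_irr : irreflexive e).
Implicit Types (A B N U X Y : {set V}) (x y : V).

Definition deg_in X x : nat := \sum_(y in X) e x y.

Definition deg_sum X : nat := \sum_(x in X) deg_in X x.

Lemma deg_in_setID A X x :
  A \subset X -> deg_in X x = deg_in A x + deg_in (X :\: A) x.
Proof. by move=> sAX; rewrite /deg_in (big_setID A) /= (setIidPr sAX). Qed.

Lemma deg_in_setD1 X x y : x \in X -> deg_in X y = e x y + deg_in (X :\ x) y.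
Proof. by move=> xX; rewrite /deg_in (big_setD1 x) //= e_sym. Qed.

Lemma deg_in_setU1 X x y : x \notin X -> deg_in (x |: X) y = e x y + deg_in X y.
Proof. by move=> xX; rewrite (@deg_in_setD1 _ x) ?setU11 // setU1K. Qed.

Lemma deg_sum_setD1 X x :
  x \in X -> deg_sum X = deg_sum (X :\ x) + 2 * deg_in X x.
Proof.
move=> xX; rewrite /deg_sum (big_setD1 x) //=.
rewrite (eq_bigr (fun y => e x y + deg_in (X :\ x) y)) => [|y _]; last first.
  exact: deg_in_setD1.
rewrite big_split /= -/(deg_in _ _) (deg_in_setD1 x xX) e_irr; lia.
Qed.

Lemma deg_sum_le_max X (d : nat) :
  (forall x, x \in X -> deg_in X x <= d) -> deg_sum X <= d * #|X|.
Proof.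
by move=> led; rewrite mulnC -sum_nat_const; apply: leq_sum.
Qed.

Lemma deg_in_lt_card X x : x \in X -> deg_in X x < #|X|.
Proof.
move=> xX; rewrite (deg_in_setD1 x xX) e_irr (cardsD1 x X) xX add0n add1n ltnS.
by rewrite -sum1_card; apply: leq_sum => y _; case: (e x y).
Qed.

(** In a smallest nonempty subset of average degree at least [D], deleting a vertex of degree below
    [D / 2] would keep the average at least [D]. *)
Lemma min_degree_subset (D : nat) X : 0 < D -> 0 < #|X| ->
    D * #|X| <= deg_sum X ->
  exists Y : {set V}, [/\ Y \subset X, 0 < #|Y| &
    forall x, x \in Y -> D <= 2 * deg_in Y x].
Proof.
move=> D0 X0 DX; pose P Y := [&& Y \subset X, 0 < #|Y| & D * #|Y| <= deg_sum Y].
have PX : P X by rewrite /P subxx X0.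
case: (arg_minnP (fun Y : {set V} => #|Y|) PX) => Y /and3P[sYX Y0 DY] minY.
exists Y; split=> // x xY; rewrite leqNgt; apply/negP => ltD.
have cY : #|Y| = #|Y :\ x|.+1 by rewrite (cardsD1 x) xY.
have := minY (Y :\ x); rewrite cY ltnn /P (subset_trans (subsetDl _ _) sYX) /=.
move: DY; rewrite (deg_sum_setD1 xY) cY mulnS => DY.
have [Yx0|Yx_gt0] := posnP #|Y :\ x|; last by move=> H; suff: false by []; apply: H; lia.
have := deg_in_lt_card xY; rewrite cY Yx0 ltnS leqn0 => /eqP deg0.
move: DY; rewrite deg0 (cards0_eq Yx0) /deg_sum big_set0; lia.
Qed.

Lemma cut_sym A B :
  \sum_(x in A) deg_in B x = \sum_(x in B) deg_in A x.
Proof.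
rewrite /deg_in exchange_big; apply: eq_bigr => x _.
by apply: eq_bigr => y _; rewrite e_sym.
Qed.

(** In a maximum cut, moving one vertex to the other side gains nothing, so at least half of its
    edges cross. *)
Lemma max_cut X : exists2 A : {set V}, A \subset X &
  (forall x, x \in A -> deg_in X x <= 2 * deg_in (X :\: A) x) /\
  (forall x, x \in X :\: A -> deg_in X x <= 2 * deg_in A x).
Proof.
pose cut A := \sum_(x in A) deg_in (X :\: A) x.
have better A x : A \subset X -> x \in A ->
    cut (A :\ x) + deg_in (X :\: A) x = cut A + deg_in A x.
  move=> sAX xA; have xX := subsetP sAX _ xA.
  have XAx : X :\: (A :\ x) = x |: (X :\: A).
    apply/setP => y; rewrite !inE negb_and negbK.
    by case: eqP => [->|] //=; rewrite xX.
  have xXA : x \notin X :\: A by rewrite inE xA.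
  rewrite /cut XAx [in RHS](big_setD1 x) //=.
  rewrite (eq_bigr (fun y => e x y + deg_in (X :\: A) y)) => [|y _]; last first.
    exact: deg_in_setU1.
  rewrite big_split /= -/(deg_in _ _) (deg_in_setD1 x xA) e_irr; lia.
have s0X : set0 \subset X by apply: sub0set.
case: (@arg_maxnP _ set0 (fun A : {set V} => A \subset X) cut s0X) => A sAX maxA.
exists A => //.
(* Stated for every set of maximum cut value, so that it serves both [A] and [X :\: A]. *)
have half B x : B \subset X -> cut B = cut A -> x \in B ->
    deg_in X x <= 2 * deg_in (X :\: B) x.
  move=> sBX cB xB; have := better B x sBX xB.
  have := maxA (B :\ x) (subset_trans (subsetDl _ _) sBX).
  by rewrite cB (deg_in_setID x sBX); lia.
split=> x xA; first exact: half.
have XXA : X :\: (X :\: A) = A by rewrite setDDr setDv set0U (setIidPr sAX).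
rewrite -XXA; apply: half => //; first exact: subsetDl.
by rewrite /cut XXA cut_sym.
Qed.

(** The factor 4 comes from two halvings: from average to minimum degree, then from the maximum cut.
    The larger side is named [A]. *)
Lemma dense_bipartite (D : nat) X : 0 < D -> 0 < #|X| ->
    D * #|X| <= deg_sum X ->
  exists A B : {set V}, [/\ A :|: B \subset X, [disjoint A & B], #|B| <= #|A|,
    0 < #|B| & forall x, x \in A -> D <= 4 * deg_in B x].
Proof.
move=> D0 X0 DX; have [Y [sYX Y0 degY]] := min_degree_subset D0 X0 DX.
have [A sAY [degA degB]] := max_cut Y.
have degA' x : x \in A -> D <= 4 * deg_in (Y :\: A) x.
  move=> xA; have := degA x xA; have := degY x (subsetP sAY _ xA); lia.
have degB' x : x \in Y :\: A -> D <= 4 * deg_in A x.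
  move=> xB; have := degB x xB; have [xY _] := setDP xB.
  by have := degY x xY; lia.
have sAYX : A :|: Y :\: A \subset X.
  by rewrite subUset (subset_trans sAY) //= (subset_trans (subsetDl _ _) sYX).
have nonempty A' B' : (forall x, x \in A' -> D <= 4 * deg_in B' x) ->
    0 < #|A'| -> 0 < #|B'|.
  move=> deg' /card_gt0P[x /deg']; rewrite !lt0n; apply: contraTneq => B0.
  by rewrite (cards0_eq B0) /deg_in big_set0 muln0 -ltnNge.
have cY : #|A| + #|Y :\: A| = #|Y|.
  by rewrite -(cardsID A Y) (setIidPr sAY).
have disAB : [disjoint A & Y :\: A].
  by rewrite -setI_eq0 setIDA setIC -setIDA setDv setI0.
have [leBA|/ltnW leAB] := leqP #|Y :\: A| #|A|.
  exists A, (Y :\: A); split=> //; apply: (nonempty A) => //; lia.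
exists (Y :\: A), A; split=> //; first by rewrite setUC.
- by rewrite disjoint_sym.
- apply: (nonempty (Y :\: A)) => //; lia.
Qed.

Lemma card_unordered_pairs (F : {set {set V}}) :
  #|[set p : V * V | (p.1 != p.2) && ([set p.1; p.2] \in F)]| <= 2 * #|F|.
Proof.
rewrite -sum1_card (partition_big (fun p => [set p.1; p.2]) (mem F)) /=; last first.
  by move=> p; rewrite inE => /andP[].
rewrite mulnC -sum_nat_const; apply: leq_sum => f fF.
rewrite sum1dep_card.
set P := [set _ | _]; have [->|[[a b] abP]] := set_0Vmem P; first by rewrite cards0.
apply: leq_trans (_ : #|[set (a, b); (b, a)]| <= 2); last by rewrite cards2; case: eqP.
apply/subset_leq_card/subsetP => -[c d].
move: abP; rewrite !inE /= => /andP[/andP[ab _] /eqP <-].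
move=> /andP[/andP[cd _] /eqP/setP eqf].
have := eqf c; have := eqf d; have := eqf a; have := eqf b.
rewrite !inE !xpair_eqE !eqxx ?orbT /= ![a == _]eq_sym ![b == _]eq_sym.
move: ab cd; rewrite ![_ == b]eq_sym.
by do !case: eqP => //= ?; subst.
Qed.

(** An edge outside [F] that meets [U] stays within [U :|: N]; one that misses [U] lies in
    [X :\: U]. Each edge of [F] accounts for two ordered pairs. *)
Lemma deg_sum_cut X U N (F : {set {set V}}) : U \subset X -> N \subset X ->
    (forall x y, x \in U -> y \in X -> e x y -> [set x; y] \notin F ->
       y \in U :|: N) ->
  deg_sum X <= deg_sum (U :|: N) + deg_sum (X :\: U) + 2 * #|F|.
Proof.
move=> sUX sNX UN; have sUNX : U :|: N \subset X by rewrite subUset sUX.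
have indic (W : {set V}) : W \subset X ->
    deg_sum W = \sum_(x in X) \sum_(y in X) [&& x \in W, y \in W & e x y].
  move=> sWX; rewrite /deg_sum [RHS](big_setID W) /= (setIidPr sWX).
  rewrite [X in _ + X]big1 => [|x /setDP[_ /negbTE xW]]; last first.
    by apply: big1 => y _; rewrite xW.
  rewrite addn0; apply: eq_bigr => x xW; rewrite /deg_in xW /=.
  rewrite [RHS](big_setID W) /= (setIidPr sWX).
  rewrite [X in _ + X]big1 => [|y /setDP[_ /negbTE yW]]; last by rewrite yW.
  by rewrite addn0; apply: eq_bigr => y ->.
have leF : \sum_(x in X) \sum_(y in X) ((x != y) && ([set x; y] \in F))
    <= 2 * #|F|.
  apply: leq_trans (card_unordered_pairs F); rewrite pair_big /=.
  rewrite -sum1_card [leqRHS]big_mkcond [leqLHS]big_mkcond /=.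
  by apply: leq_sum => p _; rewrite inE; case: ifP; case: (_ && _).
apply: leq_trans (leq_add (leqnn _) leF).
rewrite (indic _ sUNX) (indic _ (subsetDl _ _)) -!big_split.
apply: leq_sum => x xX; rewrite -!big_split; apply: leq_sum => y yX /=.
case exy: (e x y) => //=.
have -> : x != y by apply: contraTneq exy => ->; rewrite e_irr.
have [//|xyF] := boolP ([set x; y] \in F); first by rewrite addnC.
rewrite !inE xX yX !andbT.
have [xU|xU] := boolP (x \in U).
  by have := UN x y xU yX exy xyF; rewrite inE => ->.
have [yU|yU] := boolP (y \in U) => /=; last by rewrite addn0 addn1.
have := UN y x yU xX; rewrite e_sym setUC inE => /(_ exy xyF).
by rewrite (negbTE xU) /= => ->.
Qed.
End InducedDegrees.

(** The constant 8 is 4 for the passage to a bipartite graph times the 2 in the degree bound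
    [2 * r * k] of [regular_pair]. *)
Lemma regular_subrel (V : finType) (e : rel V) (r k : nat) (X : {set V}) :
    symmetric e -> irreflexive e -> (0 < r)%N -> (0 < #|X|)%N ->
    (2 * #|X| < 2 ^ k)%N -> (8 * r * k * #|X| <= deg_sum e X)%N ->
  exists (Y : {set V}) (e' : rel V), [/\ Y \subset X, (0 < #|Y|)%N,
    symmetric e', subrel e' e & forall x, x \in Y -> deg_in e' Y x = r].
Proof.
move=> e_sym e_irr r0 X0 Xk eX.
have k0 : (0 < k)%N by case: k Xk {eX} => //; lia.
have D0 : (0 < 8 * r * k)%N by rewrite !muln_gt0 r0 k0.
have [A [B [sABX disAB leBA B0 degA]]] := dense_bipartite e_sym e_irr D0 X0 eX.
(* Trimming [A] to the size of [B] leaves the degrees into [B] unchanged; a constant function turns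
   [split_by_value] into a plain choice of a subset. *)
have [A' [sA'A /eqP cA'] ] : exists A' : {set V}, A' \subset A /\ #|A'| == #|B|.
  have [-> | ] := eqVneq #|B| #|A|; first by exists A; rewrite subxx eqxx.
  move=> neBA; have ltBA : (#|B| < #|A|)%N by rewrite ltn_neqAle neBA.
  have [A' [_ [? /eqP cA' _ _ _]]] := split_by_value (fun=> 0 : int) ltBA.
  by exists A'.
pose E := [set p : V * V | e p.1 p.2].
have edgesE x T : edges_into E x T = deg_in e T x.
  by apply: eq_bigr => y _; rewrite inE.
have leBX : (#|B| <= #|X|)%N.
  by apply: subset_leq_card; apply: subset_trans sABX; apply: subsetUr.
have [||S [T [E' [[sSA' sTB T0 sE'] [degT degS]]]]] :=
    @regular_pair _ _ E A' B r k r0 B0 cA'.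
- by apply: leq_ltn_trans Xk; rewrite leq_mul2l.
- move=> x /(subsetP sA'A)/degA; rewrite edgesE; lia.
have disST x : x \in S -> x \in T -> false.
  move=> /(subsetP sSA')/(subsetP sA'A) xA /(subsetP sTB) xB.
  by have := disjointFr disAB xA; rewrite xB.
pose arc x y := [&& x \in S, y \in T & (x, y) \in E'].
pose e' x y := arc x y || arc y x.
exists (S :|: T), e'; split.
- apply: subset_trans sABX; apply: setUSS sTB.
  exact: subset_trans sSA' sA'A.
- by apply: leq_trans T0 _; apply/subset_leq_card/subsetUr.
- by move=> x y; rewrite /e' orbC.
- have arce x y : arc x y -> e x y.
    by case/and3P=> _ _ /(subsetP sE'); rewrite inE.
  by move=> x y /orP[/arce//|/arce]; rewrite e_sym.
have STT : (S :|: T) :\: S = T.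
  rewrite setDUl setDv set0U; apply/setDidPl; rewrite -setI_eq0.
  apply/eqP/setP => x; rewrite !inE; apply/negbTE/andP => -[xT xS].
  by have := disST x xS xT.
have degST x : deg_in e' (S :|: T) x = (deg_in e' S x + deg_in e' T x)%N.
  by rewrite (deg_in_setID e' x (subsetUl S T)) STT.
move=> x; rewrite degST in_setU => /orP[xS|xT].
  have xT : (x \in T) = false by apply/negP => /(disST x xS).
  rewrite -[RHS](degS x xS) [X in (X + _)%N]big1 => [|y yS].
    apply: eq_bigr => y yT; rewrite /e' /arc xS yT xT andbF orbF //.
  have yT : (y \in T) = false by apply/negP => /(disST y yS).
  by rewrite /e' /arc yT xT !andbF.
have xS : (x \in S) = false by apply/negP => xS; have := disST x xS xT.
rewrite -[RHS](degT x xT) [X in (_ + X)%N]big1 => [|y yT].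
  rewrite addn0; apply: eq_bigr => y yS; rewrite /e' /arc yS xT xS //.
have yS : (y \in S) = false by apply/negP => yS; have := disST y yS yT.
by rewrite /e' /arc yS xS.
Qed.

(** * Binary logarithms *)

Section Log2.
Variable R : realType.
Implicit Types x y p a : R.

Lemma ln2_gt0 : 0 < ln 2 :> R.
Proof. by rewrite ln_gt0 // ltr1n. Qed.

Lemma ler_log2 x y : 0 < x -> x <= y -> log2 x <= log2 y.
Proof.
move=> x0 xy; rewrite ler_pM2r ?invr_gt0 ?ln2_gt0 // ler_ln ?posrE //.
exact: lt_le_trans xy.
Qed.

Lemma log2X (n : nat) : log2 (2 ^+ n : R) = n%:R.
Proof.
rewrite /log2 lnXn // -(mulr_natr (ln 2)) mulrAC divff ?mul1r //.
by rewrite gt_eqF // ln2_gt0.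
Qed.

Lemma log2M x y : 0 < x -> 0 < y -> log2 (x * y) = log2 x + log2 y.
Proof. by move=> x0 y0; rewrite /log2 lnM ?posrE // mulrDl. Qed.

Lemma log2_exprn x (n : nat) : 0 < x -> log2 (x ^+ n) = log2 x * n%:R.
Proof. by move=> x0; rewrite /log2 lnXn // -(mulr_natr (ln x)) mulrAC. Qed.

(** Integer powers certify rational lower bounds, as needed for the logarithms of 3 and [4 / 3]. *)
Lemma log2_ge x (m n : nat) : 0 < x -> (0 < n)%N -> 2 ^+ m <= x ^+ n ->
  m%:R / n%:R <= log2 x.
Proof.
move=> x0 n0 le_mn; rewrite ler_pdivrMr ?ltr0n // -log2_exprn // -log2X.
by apply: ler_log2 => //; rewrite exprn_gt0.
Qed.

Lemma log2_ge1 x : 2 <= x -> 1 <= log2 x.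
Proof. move=> x2; apply: le_trans (_ : log2 (2 ^+ 1) <= _); first by rewrite log2X.
by rewrite expr1 ler_log2. Qed.

(** With [p = C - 2] and [x] the number of vertices, this is the [mu] of the theorem. *)
Definition loss p x := log2 x `^ (- p).

Lemma loss_le p x y : 0 <= p -> 2 <= x -> x <= y -> loss p y <= loss p x.
Proof.
move=> p0 x2 xy; have lx := log2_ge1 x2.
have lx0 : 0 < log2 x by apply: lt_le_trans lx.
have lxy : log2 x <= log2 y by apply: ler_log2 => //; apply: lt_le_trans x2.
have ly0 := lt_le_trans lx0 lxy.
rewrite /loss !powRN lef_pV2 ?posrE ?powR_gt0 //.
by rewrite ge0_ler_powR // nnegrE ltW.
Qed.

(** [2 ^ 3 <= 3 ^ 2] gives [log2 3 >= 3 / 2], and [p = 2] is the worst exponent. *)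
Lemma loss3_le p : 2 <= p -> loss p 3 <= 4 / 9.
Proof.
move=> p2; have l3 : 3 / 2 <= log2 3 :> R by apply: (@log2_ge _ 3 2) => //; lra.
have l0 : 0 < log2 3 :> R by lra.
rewrite /loss powRN.
have -> : 4 / 9 = ((3 / 2) ^+ 2)^-1 :> R by field.
rewrite lef_pV2 ?posrE ?powR_gt0 ?exprn_gt0 //; last by lra.
apply: le_trans (_ : log2 3 ^+ 2 <= _).
  by rewrite lerXn2r ?nnegrE //; lra.
by rewrite -powR_mulrn ?(ltW l0) // ler_powR //; lra.
Qed.

(* Bernoulli's inequality for the convex function [x |-> x `^ (- p)]. *)
Lemma powRN_gap p x a : 0 <= p -> 0 <= a -> a < x ->
  x `^ (- p) + p * a * x `^ (- (p + 1)) <= (x - a) `^ (- p).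
Proof.
move=> p0 a0 ax; have x0 : 0 < x by apply: le_lt_trans ax.
have xa0 : 0 < (x - a) / x by rewrite divr_gt0 // subr_gt0.
have -> : (x - a) `^ (- p) = x `^ (- p) * ((x - a) / x) `^ (- p).
  rewrite -powRM ?(ltW x0) ?(ltW xa0) //.
  by rewrite mulrC divfK // lt0r_neq0.
have -> : x `^ (- (p + 1)) = x `^ (- p) * x^-1.
  by rewrite opprD powRD ?powR_inv1 ?(ltW x0) // lt0r_neq0 ?implybT.
rewrite mulrCA -[X in X + _]mulr1 -mulrDr ler_wpM2l ?powR_ge0 //.
rewrite /powR gt_eqF //; apply: le_trans (expR_ge1Dx _).
rewrite lerD2l mulNr -mulrN -mulrA ler_wpM2l //.
have -> : (x - a) / x = 1 + (- (a / x)) by field; rewrite lt0r_neq0.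
rewrite lerNr; apply: le_ln1Dx.
by rewrite ltrNr opprK ltr_pdivrMr ?mul1r.
Qed.
End Log2.

(** * Expanders in regular graphs *)

Section InducedGraph.
Variables (V : finType) (e : rel V) (X : {set V}).
Hypotheses (e_sym : symmetric e) (e_irr : irreflexive e).

Definition induced_edges : {set {set V}} :=
  [set f : {set V} | [&& f \subset X, #|f| == 2
    & [forall x in f, forall y in f, (x != y) ==> e x y]]].

Lemma induced_edges_wf :
  [forall f in induced_edges, (f \subset X) && (#|f| == 2)].
Proof. by apply/forall_inP => f; rewrite inE => /and3P[-> ->]. Qed.

Definition induced_graph : graph V := Graph induced_edges_wf.

Lemma adj_induced x y : adj induced_graph x y = [&& x \in X, y \in X & e x y].
Proof.
rewrite /adj inE subUset !sub1set cards2.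
have [-> | neq] := eqVneq x y; first by rewrite e_irr !andbF.
rewrite -andbA; congr [&& _, _ & _].
apply/forall_inP/idP => [/(_ x)|exy u].
  by rewrite !inE eqxx => /(_ isT)/forall_inP/(_ y); rewrite !inE eqxx orbT neq; apply.
rewrite !inE => /orP[] /eqP ->; apply/forall_inP => v.
  by rewrite !inE => /orP[] /eqP ->; rewrite ?eqxx // exy implybT.
by rewrite !inE => /orP[] /eqP ->; rewrite ?eqxx // e_sym exy implybT.
Qed.

Lemma deg_induced x : x \in X -> deg induced_graph x = deg_in e X x.
Proof.
move=> xX; rewrite /deg /deg_in -sum1_card big_mkcond [RHS]big_mkcond /=.
apply: eq_bigr => y _; rewrite inE adj_induced xX /=.
by case: (y \in X) => //=; case: (e x y).
Qed.

Lemma sum_deg_induced :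
  (\sum_(x in vset induced_graph) deg induced_graph x = deg_sum e X)%N.
Proof. by apply: eq_bigr => x; apply: deg_induced. Qed.
End InducedGraph.

Lemma adj_sym (V : finType) (G : graph V) : symmetric (adj G).
Proof. by move=> x y; rewrite /adj setUC. Qed.

Lemma adj_irr (V : finType) (G : graph V) : irreflexive (adj G).
Proof.
move=> x; apply/negP => /(forall_inP (eset_wf G))/andP[_].
by rewrite setUid cards1.
Qed.

Lemma sum_deg (V : finType) (G : graph V) :
  (\sum_(x in vset G) deg G x = deg_sum (adj G) (vset G))%N.
Proof.
apply: eq_bigr => x _; rewrite /deg /deg_in -sum1_card.
rewrite big_mkcond [RHS]big_mkcond; apply: eq_bigr => y _; rewrite inE.
by case: (y \in _) => //=; case: (adj _ _ _).
Qed.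

Lemma min_deg_ge (R : numDomainType) (V : finType) (G : graph V) (D : R) :
    (0 < #|vset G|)%N -> (forall x, x \in vset G -> D <= (deg G x)%:R) ->
  D <= (min_deg G)%:R.
Proof.
move=> /card_gt0P[x0 x0G] degD.
(* The default value of the minimum has to meet the bound too; the vertex [x0] ensures it. *)
have Dmax : D <= (max_deg G)%:R.
  by apply: le_trans (degD x0 x0G) _; rewrite ler_nat leq_bigmax_cond.
rewrite /min_deg; elim/big_ind: _ => // m n Dm Dn.
by rewrite /minn; case: ifP.
Qed.

(* [H] is the induced subgraph on a smallest vertex set whose average degree is
   at least [d * (1 - loss (C - 2) |X|)]; the bound [3 <= #|X|] excludes the
   pairs of vertices, for which [loss] is 1 and the requirement is void. *)
Lemma regular_expander (R : realType) (C : R) (d : nat) (V : finType)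
    (e : rel V) (Y : {set V}) :
    4 <= C -> (4 <= d)%N -> symmetric e -> irreflexive e -> (0 < #|Y|)%N ->
    (forall x, x \in Y -> deg_in e Y x = d) ->
  exists2 X : {set V}, X \subset Y &
    let H := induced_graph e X in
    let logH : R := log2 #|vset H|%:R in
    let c : R := C * (C - 1) / (C - 2) in
    [/\ expander (1 / 8) c (d%:R / (4 * logH `^ c)) H,
        (max_deg H <= d)%N,
        d%:R * (1 - logH `^ (- (C - 2))) <= avg_deg R H &
        avg_deg R H / 2 <= (min_deg H)%:R].
Proof.
move=> C4 d4 e_sym e_irr Y0 degY.
have p2 : 2 <= C - 2 by lra.
have p0 : 0 <= C - 2 by lra.
have d0 : 0 < d%:R :> R by rewrite ltr0n; lia.
have d4R : 4 <= d%:R :> R by rewrite (ler_nat _ 4).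
pose dense (X : {set V}) := (d%:R * (1 - loss (C - 2) #|X|%:R) * #|X|%:R
  <= (deg_sum e X)%:R :> R).
pose P (X : {set V}) := [&& X \subset Y, (3 <= #|X|)%N & dense X].
have lossge0 x : 0 <= loss (C - 2) x by apply: powR_ge0.
have loss3 (x : R) : 3 <= x -> loss (C - 2) x <= 4 / 9.
  move=> x3; apply: le_trans (loss3_le p2); apply: loss_le => //; lra.
have Y5 : (4 < #|Y|)%N.
  move/card_gt0P: Y0 => [x xY]; have := deg_in_lt_card e_sym e_irr xY.
  by rewrite degY //; apply: leq_ltn_trans.
have PY : P Y.
  rewrite /P subxx /dense /=; apply/andP; split; first exact: ltnW (ltnW Y5).
  have -> : deg_sum e Y = (#|Y| * d)%N.
    by rewrite -sum_nat_const; apply: eq_bigr.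
  rewrite natrM [leRHS]mulrC ler_wpM2r // -[leRHS]mulr1 ler_wpM2l ?(ltW d0) //.
  by rewrite gerBl.
case: (arg_minnP (fun X : {set V} => #|X|) PY) => X /and3P[sXY X3 denseX] minX.
(* Three vertices have average degree at most 2, while [dense] asks for at least
   [4 * (1 - 4 / 9) = 20 / 9]. *)
have X4 : (3 < #|X|)%N.
  rewrite ltn_neqAle X3 andbT; apply/eqP => X3'.
  have : (deg_sum e X <= 2 * #|X|)%N.
    apply: deg_sum_le_max => x xX.
    by have := deg_in_lt_card e_sym e_irr xX; rewrite -X3'.
  rewrite -(ler_nat R) => le6; have := le_trans denseX le6.
  rewrite natrM ler_pM2r ?ltr0n -?X3' //.
  have := loss3 3 (lexx _); have := lossge0 3.
  by move: (loss _ _) => l; nra.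
pose h : R := #|X|%:R.
have h4 : 4 <= h by rewrite (ler_nat _ 4).
(* For [#|W| >= 3] this is minimality of [X] and monotonicity of [loss]. On at most two vertices the
   degrees are at most 1, below [d * (1 - 4 / 9)]. *)
have small (W : {set V}) (k : R) : W \subset X -> (#|W| < #|X|)%N -> 3 <= k ->
    #|W|%:R <= k ->
    (deg_sum e W)%:R <= d%:R * (1 - loss (C - 2) k) * #|W|%:R :> R.
  move=> sWX ltWX k3 leWk; have := loss3 k k3 => lk.
  have [W3|W3] := leqP 3 #|W|.
    have : ~~ P W by apply: contraL ltWX => /minX; rewrite -leqNgt.
    rewrite /P W3 (subset_trans sWX sXY) /= /dense -ltNge => /ltW le.
    apply: le_trans le _; rewrite ler_wpM2r // ler_wpM2l ?(ltW d0) //.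
    rewrite lerB // loss_le //.
    by rewrite (ler_nat _ 2); apply: ltnW.
  apply: (@le_trans _ _ (1 * #|W|)%:R).
    rewrite ler_nat; apply: deg_sum_le_max => x xW.
    by rewrite -ltnS; apply: leq_trans (deg_in_lt_card e_sym e_irr xW) _.
  by rewrite natrM ler_wpM2r // -[1%:R]/(1 : R); nra.
exists X => // H logH c.
have avgE : avg_deg R H = (deg_sum e X)%:R / h.
  by rewrite /avg_deg sum_deg_induced.
have h0 : 0 < h by lra.
have l2 : 2 <= logH.
  rewrite -[X in X <= _](log2X R 2); apply: ler_log2; first by rewrite exprn_gt0.
  by apply: le_trans h4; lra.
split.
- move=> U F /= sUX sFE U1 leU leF; rewrite leNgt; apply/negP => ltN.
  set N := nbhd _ U in ltN.
  have sNX : N \subset X.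
    by apply/subsetP => x; rewrite inE => /andP[/setDP[]].
  have disUN : [disjoint U & N].
    rewrite disjoint_sym disjoint_subset; apply/subsetP => x.
    by rewrite inE => /andP[/setDP[]].
  have cut := deg_sum_cut e_sym e_irr sUX sNX (F := F).
  have {cut} : (deg_sum e X <= deg_sum e (U :|: N) + deg_sum e (X :\: U)
      + 2 * #|F|)%N.
    apply: cut => x y xU yX exy xyF; rewrite inE; apply/orP.
    have [yU|yU] := boolP (y \in U); [by left|right].
    rewrite inE /= !inE yU yX /=; apply/existsP; exists x; rewrite xU /=.
    rewrite /adj /= in_setD xyF /= -/(adj (induced_graph e X) x y).
    by rewrite adj_induced // (subsetP sUX) // yX.
  rewrite -(ler_nat R) natrD natrD natrM => cut.
  have cUN : #|U :|: N| = (#|U| + #|N|)%N.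
    by rewrite cardsU (disjoint_setI0 disUN) cards0 subn0.
  pose u : R := #|U|%:R; pose v : R := #|N|%:R.
  have u0 : 0 < u by rewrite ltr0n.
  have v0 : 0 <= v by [].
  pose L := logH `^ c.
  (* As [c >= C - 1], the quantity [L] dominates the power of [logH] that [powRN_gap] produces for
     [p = C - 2]. *)
  have Lge : logH `^ (C - 2 + 1) <= L.
    rewrite ler_powR; [by []|lra|].
    rewrite /c ler_pdivlMr; last by lra.
    by nra.
  have lC0 : 0 < logH `^ (C - 2 + 1) by apply: powR_gt0; lra.
  have L0 : 0 < L by apply: lt_le_trans Lge.
  have L1 : L^-1 <= 1.
    rewrite invf_le1 //; apply: le_trans Lge.
    apply: le_trans (_ : logH `^ 0 <= _); first by rewrite powRr0.
    by rewrite ler_powR; lra.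
  have Li0 : 0 < L^-1 by rewrite invr_gt0.
  have ltv : v < 1 / 8 * L^-1 * u by [].
  have leF' : #|F|%:R <= d%:R / 4 * L^-1 * u.
    by apply: le_trans leF _; rewrite invfM mulrA.
  have leu : u <= 2 / 3 * h by [].
  (* [2 / 3 * (1 + 1 / 8) = 3 / 4]. *)
  have le34 : u + v <= 3 / 4 * h by nra.
  have hk : 3 <= 3 / 4 * h by lra.
  have sUNX : U :|: N \subset X by rewrite subUset sUX.
  have leUN : (deg_sum e (U :|: N))%:R
      <= d%:R * (1 - loss (C - 2) (3 / 4 * h)) * (u + v).
    have := @small (U :|: N) (3 / 4 * h) sUNX _ hk.
    rewrite cUN natrD -/u -/v; apply=> //.
    by rewrite -(ltr_nat R) natrD -/u -/v -/h; lra.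
  have cXU : #|X :\: U|%:R = h - u.
    by rewrite cardsDS // natrB // subset_leq_card.
  have leXU : (deg_sum e (X :\: U))%:R
      <= d%:R * (1 - loss (C - 2) h) * (h - u).
    have := @small (X :\: U) h (subsetDl _ _).
    rewrite cXU; apply; [|lra|lra].
    by rewrite -(ltr_nat R) cXU -/h; lra.
  (* Shrinking [h] to [3 / 4 * h] lowers the logarithm by [log2 (4 / 3) >= 1 / 3]; with [C - 2 >= 2]
     this yields the factor [2 / 3]. *)
  have gap : loss (C - 2) h + 2 / 3 * L^-1 <= loss (C - 2) (3 / 4 * h).
    have log43 : 1 / 3 <= log2 (4 / 3) :> R.
      by apply: (@log2_ge _ _ 1 3) => //; lra.
    have logE : log2 (3 / 4 * h) = logH - log2 (4 / 3).
      have -> : logH = log2 (4 / 3 * (3 / 4 * h)).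
        by rewrite -[logH]/(log2 h); congr log2; field.
      by rewrite (@log2M _ (4 / 3)); [ring|lra|lra].
    have a0 : 0 <= log2 (4 / 3) :> R by lra.
    have ltl : log2 (4 / 3) < logH.
      rewrite -subr_gt0 -logE; apply: lt_le_trans (log2_ge1 _); first by [].
      by lra.
    rewrite /loss logE -[log2 h]/logH.
    apply: le_trans (powRN_gap p0 a0 ltl); rewrite lerD2l.
    rewrite powRN; apply: (@le_trans _ _ (2 / 3 * (logH `^ (C - 2 + 1))^-1)).
      by rewrite ler_wpM2l ?lef_pV2 ?posrE //; lra.
    rewrite ler_wpM2r ?invr_ge0 ?powR_ge0 //.
    by nra.
  have l1 := loss3 _ hk; have l0 := lossge0 (3 / 4 * h).
  have : d%:R * (1 - loss (C - 2) h) * h <=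
     d%:R * (1 - loss (C - 2) (3 / 4 * h)) * (u + v) +
     d%:R * (1 - loss (C - 2) h) * (h - u) + 2 * (d%:R / 4 * L^-1 * u).
    apply: le_trans denseX _; apply: le_trans cut _.
    by apply: lerD; [apply: lerD|rewrite ler_wpM2l].
  move: gap l1 l0 ltv.
  move: (loss _ h) (loss _ (_ * h)) => a b gap l1 l0 ltv.
  rewrite (_ : d%:R * (1 - b) * (u + v) + d%:R * (1 - a) * (h - u)
     + 2 * (d%:R / 4 * L^-1 * u)
     = d%:R * ((1 - b) * (u + v) + (1 - a) * (h - u) + L^-1 * u / 2));
    last by field; rewrite lt0r_neq0.
  rewrite -mulrA ler_pM2l //.
  (* In units of [L^-1 * u], the density gap is worth at least [2 / 3], while [N] contributes at
     most [1 / 8] and [F] at most [1 / 2], too little in total. *)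
  have : (1 - b) * v <= v by rewrite ler_piMl //; lra.
  have : (2 / 3 * L^-1) * u <= (b - a) * u by rewrite ler_wpM2r //; lra.
  have : 0 < L^-1 * u by rewrite mulr_gt0.
  by lra.
- apply/bigmax_leqP => x xX; rewrite deg_induced //.
  by rewrite -(degY x (subsetP sXY x xX)); rewrite (deg_in_setID e x sXY) leq_addr.
- by rewrite avgE ler_pdivlMr.
apply: min_deg_ge => [|x xX]; first exact: leq_trans X4.
rewrite deg_induced // avgE leNgt; apply/negP => ltx.
have cX : #|X :\ x|%:R = h - 1 by rewrite /h (cardsD1 x X) xX natrD [1 + _]addrC addrK.
(* Deleting a vertex below half the average degree would raise the average, against this bound from
   minimality. *)
have : (deg_sum e (X :\ x))%:R <= d%:R * (1 - loss (C - 2) h) * (h - 1).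
  rewrite -cX; apply: small; rewrite ?subsetDl ?cX //; [|lra|lra].
  by rewrite -(ltr_nat R) cX -/h; lra.
move: denseX ltx; rewrite /dense -/h (deg_sum_setD1 e_sym e_irr xX) natrD natrM.
move: (deg_sum e _)%:R (deg_in e X x)%:R (loss _ h) => s' t a.
move=> denseX'; rewrite -[_ / h / 2]mulrA -invfM ltr_pdivlMr ?mulr_gt0 // => ltx le'.
have : (h - 1) * (d%:R * (1 - a)) * h <= (h - 1) * (s' + 2 * t).
  by rewrite -mulrA ler_wpM2l //; lra.
have : s' * h <= d%:R * (1 - a) * (h - 1) * h by rewrite ler_wpM2r //; lra.
by nra.
Qed.

(** * Expanders in dense graphs *)

Theorem corollary4p2 (R : realType) :
  exists gamma : R, exists n0 : nat,
  forall n : nat, (n0 <= n)%N ->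
  forall C : R, 4 <= C ->
  forall d : nat, 2 * log2 (n%:R : R) <= d%:R ->
  forall (T : finType) (G : graph T), #|vset G| = n ->
  gamma * d%:R * log2 n%:R <= avg_deg R G ->
  exists H : graph T,
    let logH : R := log2 #|vset H|%:R in
    let c : R := C * (C - 1) / (C - 2) in
    let s : R := d%:R / (4 * logH `^ c) in
    let mu : R := logH `^ (- (C - 2)) in
    subgraph H G /\
    expander (1 / 8) c s H /\
    (max_deg H <= d)%N /\
    d%:R * (1 - mu) <= avg_deg R H /\
    avg_deg R H / 2 <= (min_deg H)%:R.
Proof.
(* [n >= 4] gives [log2 n >= 2], hence [d >= 4]. The constant 16 is the 8 of [regular_subrel] times
   2, from [m + 2 <= 2 * log2 n]. *)
exists 16, 4%N => n n4 C C4 d dn T G cG avgG.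
have n0 : (0 < n)%N by apply: leq_trans n4.
have n0R : 0 < n%:R :> R by rewrite ltr0n.
have l2 : 2 <= log2 (n%:R : R).
  rewrite -[leLHS](log2X R 2); apply: ler_log2; first by rewrite exprn_gt0.
  by rewrite -natrX ler_nat.
have d4 : (4 <= d)%N by rewrite -(ler_nat R); lra.
(* The exponent passed to [regular_subrel] is [m.+2]: from [n < 2 ^ m.+1] follows
   [2 * n < 2 ^ m.+2]. *)
pose m := trunc_log 2 n.
have /andP[le_mn lt_nm] := trunc_log_bounds (isT : 1 < 2)%N n0.
have lem : m%:R <= log2 (n%:R : R).
  rewrite -[leLHS]log2X; apply: ler_log2; first by rewrite exprn_gt0.
  by rewrite -natrX ler_nat.
have degG : (8 * d * m.+2 * #|vset G| <= deg_sum (adj G) (vset G))%N.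
  rewrite -sum_deg -(ler_nat R) cG natrM -ler_pdivlMr //.
  apply: le_trans (_ : 16 * d%:R * log2 n%:R <= _); last first.
    by rewrite /avg_deg cG in avgG.
  rewrite !natrM -[m.+2]addn2 natrD.
  have : 0 <= d%:R :> R by [].
  by nra.
have [Y [e [sYG Y0 e_sym sub_e degY]]] : exists (Y : {set T}) (e : rel T),
    [/\ Y \subset vset G, (0 < #|Y|)%N, symmetric e, subrel e (adj G)
      & forall x, x \in Y -> deg_in e Y x = d].
  apply: (regular_subrel (@adj_sym _ G) (@adj_irr _ G) _ _ _ degG).
  - exact: leq_trans d4.
  - by rewrite cG.
  - by rewrite cG expnS ltn_pmul2l.
have e_irr : irreflexive e.
  by move=> x; apply/negP => /sub_e; rewrite adj_irr.
have [X sXY [expH maxH avgH minH]] :=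
  regular_expander C4 d4 e_sym e_irr Y0 degY.
exists (induced_graph e X) => logH c s mu; split=> //.
rewrite /subgraph /= (subset_trans sXY sYG) /=.
apply/subsetP => f; rewrite inE => /and3P[_ /cards2P[x [y [neq ->]]]].
move=> /forall_inP/(_ x); rewrite !inE eqxx => /(_ isT)/forall_inP/(_ y).
by rewrite !inE eqxx orbT neq => /(_ isT)/sub_e.
Qed.
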